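(* Let $K$ be a field, let $f = x^C(x^A - \rho x^B) \in K[x_1,\dots,x_n]$ with $\rho \in K^\times$ and $A,B,C \in \mathbb{Z}_{\ge 0}^n$ such that $A_iB_i = 0$ for all $i \in \{1,\dots,n\}$, set $g := x^A - \rho x^B$ and $\iota(g) = (\alpha,\mathfrak a,\beta,\mathfrak b)$. Suppose that $f$ satisfies condition (N) of the context, and let $I\subseteq\{1,\dots,n\}$ be an index set chosen according to the following rule: (i) if $\min\{\alpha,\beta\}\ge 2$ or $\min\{|A|,|B|\}=1$, then $I=\{j_1,j_2\}$ with $A_{j_1}=\alpha$ and $B_{j_2}=\beta$; (ii) if $\alpha=1$, $\beta\ge2$ and $\min\{|A|,|B|\}\ge2$, then $I=\{j_1,j_2,j_3\}$ with $j_1,j_2,j_3$ pairwise distinct, $A_{j_1}=A_{j_2}=1$ and $B_{j_3}=\beta$; (iii) if $\alpha\ge2$, $\beta=1$ and $\min\{|A|,|B|\}\ge2$, then $I=\{j_1,j_2,j_3\}$ with $j_1,j_2,j_3$ pairwise distinct, $A_{j_1}=\alpha$ and $B_{j_2}=B_{j_3}=1$; (iv) if $\alpha=\beta=1$ and $\min\{|A|,|B|\}\ge2$, then $I=\{j_1,j_2,j_3,j_4\}$ with $j_1,j_2,j_3,j_4$ pairwise distinct and $A_{j_1}=A_{j_2}=B_{j_3}=B_{j_4}=1$. Let $\pi : \mathrm{Bl}_{D_I}(\mathbb{A}^n_K) \to \mathbb{A}^n_K$ be the blowup with center $D_I := V(x_i\mid i\in I)$. Then in every standard chart $D_+(X_j)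 \cong \mathbb{A}^n_K$, $j \in I$, with coordinates $x' = (x_1',\dots,x_n')$, writing the total transform of $f$ as $x'^{C'}(x'^{A'} - \rho x'^{B'})$ with $A_i'B_i' = 0$ for all $i$ and setting $g' := x'^{A'} - \rho x'^{B'}$, we have $$\iota(g') <_{\mathrm{lex}} \iota(g).$$ In particular, the local monomialization process obtained by choosing all centers according to this rule (for arbitrary admissible choices of $I$) terminates.
   Context: Notation: for $A=(A_1,\dots,A_n)\in\mathbb{Z}_{\ge0}^n$, $x^A := x_1^{A_1}\cdots x_n^{A_n}$ and $|A| := \sum_{i=1}^n A_i$. Invariant: for $g = x^A - \rho x^B$ as in the claim (with a fixed order $(A,B)$ of the two monomials), $\alpha(g):=\max_i A_i$, $\mathfrak a(g) := \#\{i \mid A_i = \alpha(g)\}$, $\beta(g) := \max_i B_i$, $\mathfrak b(g) := \#\{i\mid B_i = \beta(g)\}$ (with $i$ ranging over $\{1,\dots,n\}$), and $\iota(g) := (\alpha(g),\mathfrak a(g),\beta(g),\mathfrak b(g)) \in\mathbb{Z}_{\ge0}^4$, with $\mathbb{Z}_{\ge0}^4$ ordered lexicographically. For $g'$ one uses the pair $(A',B')$ in this order. Conditions: for $f = x^C(x^A - \rho x^B)$ with $A_iB_i=0$ for all $i$, condition (M) is: either $\min\{|A|,|B|\} = 0$, or there is an index $i$ with $C_i = 0$ such that ($|A| = 1$ and $A_i = 1$) or ($|B|=1$ and $B_i=1$). Condition (N) is the negation of (M): either $\min\{|A|,|B|\}\ge 2$, or $\min\{|A|,|B|\} = 1$ and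 $C_i \ne 0$ for every $i$ such that ($|A|=1$ and $A_i=1$) or ($|B|=1$ and $B_i = 1$). (If (M) holds, then $f$ is locally a monomial, i.e. at every point it is a monomial times a unit in a suitable regular system of parameters.) Blowup charts: for $I\subseteq\{1,\dots,n\}$ the blowup of $\mathbb{A}^n_K$ in $V(x_i\mid i\in I)$ is covered by charts $D_+(X_j)\cong \mathbb{A}^n_K$, $j\in I$, on which it is given by $x_k\mapsto x_j'x_k'$ for $k\in I\setminus\{j\}$ and $x_k\mapsto x_k'$ for $k=j$ or $k\notin I$. The total transform of $f$ in the chart is its image in $K[x']$. On exponents, with $\delta := \min\{\sum_{k\in I}A_k,\sum_{k\in I}B_k\}$, one has $A'_j = \sum_{k\in I}A_k - \delta$, $B'_j=\sum_{k\in I}B_k-\delta$, $C'_j = \sum_{k\in I}C_k+\delta$, and all other entries of $A,B,C$ are unchanged. Local monomialization process: start with the chart $\mathbb{A}^n_K$ and $f$. If the data $(A,B,C)$ of a chart satisfies (M), the chart is final. Otherwise choose a center $D_I$ by the given rule applied to that chart's $(A,B,C)$ (independently of the other charts), blow up, and continue in each chart $D_+(X_j)$, $j\in I$, with the total transform $x'^{C'}(x'^{A'}-\rho x'^{B'})$. The process terminates if the resulting tree of charts is finite (so that all its leaves satisfy (M)), whatever choices of centers are made. *)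

(* Defs.v *)
From HB Require Import structures.
From mathcomp Require Import all_boot all_order all_algebra.
From mathcomp Require Export mpoly.

Set Implicit Arguments.
Unset Strict Implicit.
Unset Printing Implicit Defensive.

Import Order.TTheory GRing.Theory.

(* The exponents of x^C (x^A - rho x^B).  The pair (A, B) is ordered, and [mdeg]
   is the total degree |.| of an exponent vector. *)
Record exps (n : nat) := Exps {
  eA : 'X_{1..n};
  eB : 'X_{1..n};
  eC : 'X_{1..n}
}.

Definition disjoint_exps (n : nat) (D : exps n) : Prop :=
  forall i : 'I_n, (eA D i * eB D i = 0)%N.

Definition binom_poly (K : fieldType) (n : nat) (rho : K) (D : exps n) :
    {mpoly K[n]} :=
  ('X_[eC D] * ('X_[eA D] - rho *: 'X_[eB D]))%R.

Definition max_exp (n : nat) (m : 'X_{1..n}) : nat := \max_(i < n) m i.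

Definition num_max (n : nat) (m : 'X_{1..n}) : nat :=
  #|[set i : 'I_n | m i == max_exp m]|.

Definition alpha (n : nat) (D : exps n) : nat := max_exp (eA D).
Definition beta (n : nat) (D : exps n) : nat := max_exp (eB D).
Definition min_deg (n : nat) (D : exps n) : nat :=
  minn (mdeg (eA D)) (mdeg (eB D)).

(* The type [4.-tuplelexi nat] carries the lexicographic order. *)
Definition iota_inv (n : nat) (D : exps n) : 4.-tuplelexi nat :=
  [tuple alpha D; num_max (eA D); beta D; num_max (eB D)].

Definition condM (n : nat) (D : exps n) : bool :=
  (min_deg D == 0) ||
  [exists i : 'I_n, (eC D i == 0) &&
    ((mdeg (eA D) == 1) && (eA D i == 1) ||
     (mdeg (eB D) == 1) && (eB D i == 1))].

Definition condN (n : nat) (D : exps n) : bool := ~~ condM D.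

(* The four cases are exclusive and exhaustive when [condN] holds; the rule is
   only ever applied under that hypothesis. *)
Definition admissible_center (n : nat) (D : exps n) (I : {set 'I_n}) : Prop :=
  [/\ (2 <= minn (alpha D) (beta D)) \/ (min_deg D = 1) ->
        exists j1 j2 : 'I_n,
          [/\ I = [set j1; j2], eA D j1 = alpha D & eB D j2 = beta D],
      alpha D = 1 -> 2 <= beta D -> 2 <= min_deg D ->
        exists j1 j2 j3 : 'I_n,
          [/\ I = [set j1; j2; j3], uniq [:: j1; j2; j3],
              eA D j1 = 1, eA D j2 = 1 & eB D j3 = beta D],
      2 <= alpha D -> beta D = 1 -> 2 <= min_deg D ->
        exists j1 j2 j3 : 'I_n,
          [/\ I = [set j1; j2; j3], uniq [:: j1; j2; j3],
              eA D j1 = alpha D, eB D j2 = 1 & eB D j3 = 1]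
    & alpha D = 1 -> beta D = 1 -> 2 <= min_deg D ->
        exists j1 j2 j3 j4 : 'I_n,
          [/\ I = [set j1; j2; j3; j4], uniq [:: j1; j2; j3; j4],
              eA D j1 = 1 /\ eA D j2 = 1 & eB D j3 = 1 /\ eB D j4 = 1]].

(* The comorphism K[x] -> K[x'] of the chart D_+(X_j) of the blowup of affine
   n-space in V(x_i | i in I): x_k |-> x'_j x'_k for k in I \ {j}, and
   x_k |-> x'_k otherwise. *)
Definition chart_map (K : fieldType) (n : nat) (I : {set 'I_n}) (j : 'I_n)
    (p : {mpoly K[n]}) : {mpoly K[n]} :=
  comp_mpoly
    [tuple (if k \in I :\ j then 'X_j * 'X_k else 'X_k)%R | k < n] p.

Definition upd_exp (n : nat) (m : 'X_{1..n}) (j : 'I_n) (v : nat) : 'X_{1..n} :=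
  [multinom (if i == j then v else m i) | i < n].

Definition chart_exps (n : nat) (I : {set 'I_n}) (j : 'I_n) (D : exps n) :
    exps n :=
  let sA := (\sum_(k in I) eA D k)%N in
  let sB := (\sum_(k in I) eB D k)%N in
  let sC := (\sum_(k in I) eC D k)%N in
  let delta := minn sA sB in
  Exps (upd_exp (eA D) j (sA - delta))
       (upd_exp (eB D) j (sB - delta))
       (upd_exp (eC D) j (sC + delta)).

(* [D'] writes the total transform of x^C (x^A - rho x^B) in the chart.  The
   third clause fixes the order of the pair (A', B'): for rho = -1 the second
   one is symmetric in A' and B'. *)
Definition total_transform (K : fieldType) (n : nat) (rho : K)
    (I : {set 'I_n}) (j : 'I_n) (D D' : exps n) : Prop :=
  [/\ disjoint_exps D',
      chart_map I j (binom_poly rho D) = binom_poly rho D'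
    & chart_map I j ('X_[eC D] * 'X_[eA D])%R
        = ('X_[eC D'] * 'X_[eA D'])%R :> {mpoly K[n]}].

(* Charts of the monomialization process are addressed by the sequence of
   chart indices leading to them from the initial chart, and [ctr p] is the
   index set of the center chosen in the chart with address [p].  Centers in
   different charts are thus chosen independently, even if the exponents
   coincide. *)
Fixpoint chart_at (n : nat) (ctr : seq 'I_n -> {set 'I_n}) (D : exps n)
    (p : seq 'I_n) : exps n :=
  if p is j :: q then
    chart_at (fun r => ctr (j :: r)) (chart_exps (ctr [::]) j D) q
  else D.

Fixpoint is_chart (n : nat) (ctr : seq 'I_n -> {set 'I_n}) (D : exps n)
    (p : seq 'I_n) : bool :=
  if p is j :: q then
    [&& condN D, j \in ctr [::] &
        is_chart (fun r => ctr (j :: r)) (chart_exps (ctr [::]) j D) q]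
  else true.

Definition admissible_process (n : nat) (ctr : seq 'I_n -> {set 'I_n})
    (D : exps n) : Prop :=
  forall p : seq 'I_n, is_chart ctr D p -> condN (chart_at ctr D p) ->
    admissible_center (chart_at ctr D p) (ctr p).

Definition process_terminates (n : nat) (ctr : seq 'I_n -> {set 'I_n})
    (D : exps n) : Prop :=
  (exists s : seq (seq 'I_n), forall p, is_chart ctr D p -> p \in s) /\
  (forall p, is_chart ctr D p -> (forall j, ~~ is_chart ctr D (rcons p j)) ->
     condM (chart_at ctr D p)).

(* Main.v *)
Require Import Defs.
From mathcomp Require Import all_boot all_order all_algebra zify.

(** Let [sA], [sB] be the sums of the exponents over the center and
    [d = minn sA sB].  The four cases of the rule have in common that
    [sA - d < alpha] and [sB - d < beta], and that each [j] in the center either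
    has [A j = alpha], or has [A j = 0] and [B j = beta].  In the chart of such a
    [j] only the [j]-th entries change: in the first case one of the maximal
    entries of [A] drops below [alpha]; in the second [alpha] and its
    multiplicity are unaffected and a maximal entry of [B] drops below [beta].
    Finiteness of the tree then follows by well-founded induction. *)

Set Implicit Arguments.
Unset Strict Implicit.
Unset Printing Implicit Defensive.

Import Order.TTheory GRing.Theory.

(** * Well-foundedness of the lexicographic order *)

Lemma wf_tuplelexi (n : nat) :
  well_founded (fun t u : n.-tuplelexi nat => (t < u)%O).
Proof.
elim: n => [|n IHn] t.
  by constructor => u; rewrite [u]tuple0 [t]tuple0 ltxx.
(* Inside the induction on the length: strong induction on the head, then induction on the
   accessibility of the tail. A smaller tuple has a smaller head and any tail, or the same head and
   a smaller tail. *)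
case/tupleP: t => x t; elim/ltn_ind: x t => x IHx t.
elim: (IHn t) => {}t _ IHt; constructor => u; case/tupleP: u => y u.
rewrite [(_ < _)%O]ltxi_cons.
case: (ltgtP y x) => [lt_yx _|lt_xy|-> /=]; last exact: IHt.
- exact: IHx.
- by [].
Qed.

(** * Changing one exponent: effect on the maximum and its multiplicity *)

Lemma upd_expE (n : nat) (m : 'X_{1..n}) (j : 'I_n) (v : nat) (i : 'I_n) :
  upd_exp m j v i = if i == j then v else m i.
Proof. by rewrite mnmE. Qed.

Lemma leq_max_exp (n : nat) (m : 'X_{1..n}) (i : 'I_n) : m i <= max_exp m.
Proof. exact: leq_bigmax. Qed.

Lemma max_exp_gt0 (n : nat) (m : 'X_{1..n}) : (0 < max_exp m) = (0 < mdeg m).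
Proof.
rewrite !lt0n; congr (~~ _); rewrite mdegE sum_nat_eq0 -leqn0.
apply/bigmax_leqP/forallP => h i; have := h i; rewrite /= -?leqn0 //.
by move=> ->.
Qed.

Lemma sum_set_seq (n : nat) (I : {set 'I_n}) (s : seq 'I_n) (m : 'X_{1..n}) :
  uniq s -> I =i s -> \sum_(k in I) m k = \sum_(k <- s) m k.
Proof. by move=> us eIs; rewrite big_uniq //; apply: eq_bigl. Qed.

Section UpdExp.

Variables (n : nat) (m : 'X_{1..n}) (j : 'I_n) (v : nat).
Hypothesis lt_v : v < max_exp m.

Lemma max_exp_upd_le : max_exp (upd_exp m j v) <= max_exp m.
Proof.
apply/bigmax_leqP => i _; rewrite upd_expE.
by case: eqP => _; [exact: ltnW | exact: leq_max_exp].
Qed.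

(** If the maximum survives the update, it does so at other positions, and the set of maximal
    positions loses exactly [j]. *)
Lemma max_exp_upd_drop : m j = max_exp m ->
  max_exp (upd_exp m j v) < max_exp m \/
  max_exp (upd_exp m j v) = max_exp m /\
    num_max (upd_exp m j v) < num_max m.
Proof.
move=> mj; have := max_exp_upd_le.
rewrite leq_eqVlt => /orP[/eqP e|]; [right|by left].
split=> //; apply/proper_card/properP; split.
  apply/subsetP => i; rewrite !inE upd_expE e.
  by case: (i =P j) => [-> _|//]; rewrite mj.
by exists j; rewrite !inE ?mj // upd_expE eqxx e ltn_eqF.
Qed.

Lemma max_exp_upd_keep : m j < max_exp m ->
  max_exp (upd_exp m j v) = max_exp m /\ num_max (upd_exp m j v) = num_max m.
Proof.
move=> lt_mj; have e : max_exp (upd_exp m j v) = max_exp m.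
  apply/eqP; rewrite eqn_leq max_exp_upd_le /=.
  (* A position [i] attaining the maximum differs from [j], so its entry is untouched. *)
  have [|i mi] := @bigop.eq_bigmax 'I_n m; first by apply/card_gt0P; exists j.
  have mi' : max_exp m = m i by [].
  rewrite mi'; have := leq_max_exp (upd_exp m j v) i.
  rewrite upd_expE; case: (i =P j) => // ij.
  by move: lt_mj; rewrite mi' ij ltnn.
split=> //; apply: eq_card => i; rewrite !inE upd_expE e.
by case: (i =P j) => // ->; rewrite !ltn_eqF.
Qed.

End UpdExp.

Lemma iota_inv_lt (n : nat) (D D' : exps n) :
  (max_exp (eA D') < max_exp (eA D) \/
   max_exp (eA D') = max_exp (eA D) /\ num_max (eA D') < num_max (eA D)) \/
  (max_exp (eA D') = max_exp (eA D) /\ num_max (eA D') = num_max (eA D)) /\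
  (max_exp (eB D') < max_exp (eB D) \/
   max_exp (eB D') = max_exp (eB D) /\ num_max (eB D') < num_max (eB D)) ->
  (iota_inv D' < iota_inv D)%O.
Proof.
rewrite [(_ < _)%O]ltxi_cons !ltxi_cons !leEnat /alpha /beta.
lia.
Qed.

(** * Admissible centers and the drop of the invariant *)

Section Center.

Variables (n : nat) (D : exps n) (I : {set 'I_n}).
Hypotheses (disjD : disjoint_exps D) (ND : condN D).
Hypothesis adm : admissible_center D I.

Let sA := \sum_(k in I) eA D k.
Let sB := \sum_(k in I) eB D k.

Lemma condN_gt0 : [/\ 0 < min_deg D, 0 < alpha D & 0 < beta D].
Proof.
have : 0 < min_deg D.
  by move: ND; rewrite /condN /condM negb_or lt0n => /andP[].
by rewrite /alpha /beta !max_exp_gt0 /min_deg leq_min => /[dup] /andP[-> ->] ->.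
Qed.

Lemma admissible_centerP :
  [/\ sA - minn sA sB < alpha D, sB - minn sA sB < beta D, I != set0 &
      forall j, j \in I ->
        eA D j = alpha D \/ eA D j = 0 /\ eB D j = beta D].
Proof.
have [d0 a0 b0] := condN_gt0.
have A0 k : 0 < eB D k -> eA D k = 0 by have := disjD k; nia.
have B0 k : 0 < eA D k -> eB D k = 0 by have := disjD k; nia.
have nz (J : {set 'I_n}) k : k \in J -> J != set0.
  by move=> kJ; apply/set0Pn; exists k.
case: adm => h1 h2 h3 h4.
(* Rule (i) against the rest. The sums [(sA, sB)] are [(alpha, beta)] in (i), [(2, beta)] in (ii),
   [(alpha, 2)] in (iii) and [(2, 2)] in (iv); subtracting their minimum gives the two strict bounds
   in each case. *)
have [/h1|] : (2 <= minn (alpha D) (beta D) \/ min_deg D = 1) \/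
    ((alpha D = 1 \/ beta D = 1) /\ 2 <= min_deg D) by lia.
  move=> [j1 [j2 [eI Aj1 Bj2]]].
  have Bj1 : eB D j1 = 0 by apply: B0; rewrite Aj1.
  have Aj2 : eA D j2 = 0 by apply: A0; rewrite Bj2.
  have j12 : j1 != j2 by apply/eqP => e; move: Aj1; rewrite e Aj2; lia.
  rewrite /sA /sB eI !big_setU1 ?inE //= !big_set1 Aj1 Aj2 Bj1 Bj2.
  split; try lia; first by apply: (nz _ j1); rewrite !inE eqxx.
  by move=> j; rewrite !inE => /orP[]/eqP->; [left | right].
move=> [ab d2].
have [[a1 b2]|[[a2 b1]|[a1 b1]]] : (alpha D = 1 /\ 2 <= beta D) \/
  (2 <= alpha D /\ beta D = 1) \/ (alpha D = 1 /\ beta D = 1) by lia.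
- have [j1 [j2 [j3 [eI uj Aj1 Aj2 Bj3]]]] := h2 a1 b2 d2.
  have Bj1 : eB D j1 = 0 by apply: B0; rewrite Aj1.
  have Bj2 : eB D j2 = 0 by apply: B0; rewrite Aj2.
  have Aj3 : eA D j3 = 0 by apply: A0; rewrite Bj3.
  have sumI (m : 'X_{1..n}) : \sum_(k in I) m k = m j1 + m j2 + m j3.
    rewrite (sum_set_seq m uj) => [|k]; last by rewrite eI !inE -orbA.
    by rewrite !big_cons big_nil addn0 addnA.
  rewrite /sA /sB !sumI Aj1 Aj2 Aj3 Bj1 Bj2 Bj3 a1.
  split; try lia; first by apply: (nz _ j1); rewrite eI !inE eqxx.
  by move=> j; rewrite eI !inE => /orP[/orP[]|]/eqP->; by [left | right].
- have [j1 [j2 [j3 [eI uj Aj1 Bj2 Bj3]]]] := h3 a2 b1 d2.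
  have Bj1 : eB D j1 = 0 by apply: B0; rewrite Aj1.
  have Aj2 : eA D j2 = 0 by apply: A0; rewrite Bj2.
  have Aj3 : eA D j3 = 0 by apply: A0; rewrite Bj3.
  have sumI (m : 'X_{1..n}) : \sum_(k in I) m k = m j1 + m j2 + m j3.
    rewrite (sum_set_seq m uj) => [|k]; last by rewrite eI !inE -orbA.
    by rewrite !big_cons big_nil addn0 addnA.
  rewrite /sA /sB !sumI Aj1 Aj2 Aj3 Bj1 Bj2 Bj3 b1.
  split; try lia; first by apply: (nz _ j1); rewrite eI !inE eqxx.
  by move=> j; rewrite eI !inE => /orP[/orP[]|]/eqP->; by [left | right].
- have [j1 [j2 [j3 [j4 [eI uj [Aj1 Aj2] [Bj3 Bj4]]]]]] := h4 a1 b1 d2.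
  have Bj1 : eB D j1 = 0 by apply: B0; rewrite Aj1.
  have Bj2 : eB D j2 = 0 by apply: B0; rewrite Aj2.
  have Aj3 : eA D j3 = 0 by apply: A0; rewrite Bj3.
  have Aj4 : eA D j4 = 0 by apply: A0; rewrite Bj4.
  have sumI (m : 'X_{1..n}) :
      \sum_(k in I) m k = m j1 + m j2 + m j3 + m j4.
    rewrite (sum_set_seq m uj) => [|k]; last by rewrite eI !inE -!orbA.
    by rewrite !big_cons big_nil addn0 !addnA.
  rewrite /sA /sB !sumI Aj1 Aj2 Aj3 Aj4 Bj1 Bj2 Bj3 Bj4 a1 b1.
  split; try lia; first by apply: (nz _ j1); rewrite eI !inE eqxx.
  move=> j; rewrite eI !inE => /orP[/orP[/orP[]|]|]/eqP->;
    by [left | right].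
Qed.

Lemma iota_inv_chart_exps (j : 'I_n) :
  j \in I -> (iota_inv (chart_exps I j D) < iota_inv D)%O.
Proof.
have [ltA ltB _ AB] := admissible_centerP => jI; apply: iota_inv_lt.
case: (AB _ jI) => [Aj|[Aj Bj]]; first by left; apply: max_exp_upd_drop.
right; split; last exact: max_exp_upd_drop.
by apply: max_exp_upd_keep => //; rewrite Aj; apply: leq_ltn_trans ltA.
Qed.

End Center.

(** * Total transforms in a chart *)

Lemma disjoint_chart_exps (n : nat) (I : {set 'I_n}) (j : 'I_n) (D : exps n) :
  disjoint_exps D -> disjoint_exps (chart_exps I j D).
Proof.
move=> disjD i; rewrite !upd_expE; case: (i =P j) => // _.
(* Only the [j]-th entries change, and subtracting the minimum of the two sums makes one of them
   zero. *)
by apply/eqP; rewrite muln_eq0 !subn_eq0; lia.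
Qed.

Section ChartMap.

Variables (K : fieldType) (n : nat) (I : {set 'I_n}) (j : 'I_n).

Lemma chart_mapX (m : 'X_{1..n}) : j \in I ->
  chart_map I j 'X_[K, m] = 'X_[upd_exp m j (\sum_(k in I) m k)].
Proof.
move=> jI; rewrite /chart_map comp_mpolyX.
(* [F k] is the exponent vector of the image of [x_k]. *)
pose F k : 'X_{1..n} := (U_(k) + (if k \in I :\ j then U_(j) else 0))%MM.
rewrite (eq_bigr (fun k => 'X_[K, F k] ^+ m k)%R) => [|k _]; last first.
  rewrite tnth_mktuple /F; congr (_ ^+ _)%R.
  by case: ifP => _; rewrite ?addm0 // mpolyXD mulrC.
rewrite mprodXnE; congr mpolyX; apply/mnmP => i.
rewrite upd_expE mnm_sumE.
under eq_bigr => k _ do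
  rewrite mulmnE mnmDE mnm1E [X in _ + X](fun_if (fun m : 'X_{1..n} => m i))
    mnm1E mnm0E.
(* The exponent of [x'_j] receives [m k] from every [k] in [I]; that of any other [x'_i] receives
   only [m i]. *)
case: (eqVneq i j) => [->|_].
  rewrite [RHS]big_mkcond; apply: eq_bigr => k _ /=; rewrite !inE.
  case: (eqVneq k _) => [->|_] /=; first by rewrite jI mul1n.
  by case: ifP; rewrite ?mul1n.
rewrite (bigD1 i) //= eqxx if_same mul1n big1 ?addn0 // => k ki.
by rewrite (negPf ki) if_same.
Qed.

Lemma chart_mapM (p q : {mpoly K[n]}) :
  chart_map I j (p * q)%R = (chart_map I j p * chart_map I j q)%R.
Proof. exact: rmorphM. Qed.

Lemma chart_map_binom (rho : K) (D : exps n) :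
  chart_map I j (binom_poly rho D) =
  (chart_map I j ('X_[eC D] * 'X_[eA D])
   - rho *: chart_map I j ('X_[eC D] * 'X_[eB D]))%R.
Proof.
by rewrite /binom_poly mulrBr -scalerAr /chart_map comp_mpolyB comp_mpolyZ.
Qed.

End ChartMap.

Lemma mpolyX_inj (R : nzRingType) (n : nat) :
  injective (fun m : 'X_{1..n} => 'X_[R, m]).
Proof.
move=> m1 m2 /(congr1 (mcoeff m2)); rewrite !mcoeffX eqxx.
by case: eqP => // _ /eqP; rewrite eq_sym oner_eq0.
Qed.

Lemma total_transform_chart_exps (K : fieldType) (n : nat) (rho : K)
    (I : {set 'I_n}) (j : 'I_n) (D : exps n) :
  disjoint_exps D -> j \in I -> total_transform rho I j D (chart_exps I j D).
Proof.
move=> disjD jI.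
(* Any such [d] can be moved from the monomial into the factor [x^C]. Using the same [d] for both
   monomials makes that factor common, so it can be pulled out. *)
have mapX (m : 'X_{1..n}) d : d <= \sum_(k in I) m k ->
    chart_map I j ('X_[eC D] * 'X_[m])%R =
    ('X_[upd_exp (eC D) j (\sum_(k in I) eC D k + d)] *
     'X_[upd_exp m j (\sum_(k in I) m k - d)])%R :> {mpoly K[n]}.
  move=> le_d; rewrite chart_mapM !chart_mapX // -!mpolyXD; congr mpolyX.
  by apply/mnmP => i; rewrite !mnmDE !upd_expE; case: eqP => // _; lia.
pose d := minn (\sum_(k in I) eA D k) (\sum_(k in I) eB D k).
have [dA dB] : d <= \sum_(k in I) eA D k /\ d <= \sum_(k in I) eB D k.
  by rewrite geq_minl geq_minr.
split; [exact: disjoint_chart_exps | | exact: mapX].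
by rewrite chart_map_binom (mapX _ _ dA) (mapX _ _ dB) scalerAr -mulrBr.
Qed.

(* Disjointness makes [C i] the minimum of the [i]-th exponents of the two
   monomials. *)
Lemma total_transform_uniq (K : fieldType) (n : nat) (rho : K)
    (I : {set 'I_n}) (j : 'I_n) (D D1 D2 : exps n) :
  rho != 0%R -> total_transform rho I j D D1 -> total_transform rho I j D D2 ->
  D1 = D2.
Proof.
move=> rho0 [disj1 f1 a1] [disj2 f2 a2].
have eA12 : ('X_[eC D1] * 'X_[eA D1] = 'X_[eC D2] * 'X_[eA D2] :> {mpoly K[n]})%R.
  by rewrite -a1 -a2.
(* Cancel the equal first monomials, then the nonzero scalar [rho]. *)
have eB12 : ('X_[eC D1] * 'X_[eB D1] = 'X_[eC D2] * 'X_[eB D2] :> {mpoly K[n]})%R.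
  move: f1; rewrite f2 /binom_poly !mulrBr -!scalerAr eA12.
  by move/addrI/oppr_inj/(scalerI rho0)/esym.
move: eA12 eB12; rewrite -!mpolyXD => /mpolyX_inj eA12 /mpolyX_inj eB12.
have e i : [/\ eA D1 i = eA D2 i, eB D1 i = eB D2 i & eC D1 i = eC D2 i].
  have := congr1 (fun m : 'X_{1..n} => m i) eA12.
  have := congr1 (fun m : 'X_{1..n} => m i) eB12.
  by rewrite !mnmDE; have := disj1 i; have := disj2 i; split; nia.
case: D1 D2 e {disj1 f1 a1 disj2 f2 a2 eA12 eB12} => A1 B1 C1 [A2 B2 C2] /= e.
by congr Exps; apply/mnmP => i; case: (e i).
Qed.

(** * The tree of charts *)

(** [is_chart] recurses from the root, whereas being a leaf concerns extensions at the end of an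
    address. *)
Lemma is_chart_rcons (n : nat) (ctr : seq 'I_n -> {set 'I_n}) (D : exps n)
    (p : seq 'I_n) (j : 'I_n) :
  is_chart ctr D (rcons p j) =
  [&& is_chart ctr D p, condN (chart_at ctr D p) & j \in ctr p].
Proof.
elim: p ctr D => [|k p IHp] ctr D /=; first by rewrite andbT.
by rewrite IHp !andbA.
Qed.

Lemma disjoint_chart_at (n : nat) (ctr : seq 'I_n -> {set 'I_n}) (D : exps n)
    (p : seq 'I_n) :
  disjoint_exps D -> disjoint_exps (chart_at ctr D p).
Proof.
by elim: p ctr D => //= j p IHp ctr D disjD; apply/IHp/disjoint_chart_exps.
Qed.

Lemma finitely_many_charts (n : nat) (ctr : seq 'I_n -> {set 'I_n})
    (D : exps n) :
  disjoint_exps D -> admissible_process ctr D ->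
  exists s : seq (seq 'I_n), forall p, is_chart ctr D p -> p \in s.
Proof.
have [t] : exists t, t = iota_inv D by exists (iota_inv D).
(* [ctr] is generalized because the subtree at [j] has its own choice function
   [fun r => ctr (j :: r)]. *)
elim/(well_founded_ind (@wf_tuplelexi 4)): t ctr D => t IHt ctr D et disjD adm.
have [ND|MD] := boolP (condN D); last first.
  by exists [:: [::]] => -[|j p] //=; rewrite (negPf MD).
have adm0 : admissible_center D (ctr [::]) by apply: (adm [::]).
(* The condition on [j] stands under the existential, with an empty list outside the center, so that
   one list per index can be chosen for all indices at once. *)
have IHj (j : 'I_n) : exists s : seq (seq 'I_n), j \in ctr [::] ->
    forall p, is_chart (fun r => ctr (j :: r)) (chart_exps (ctr [::]) j D) p ->
      p \in s.
  have [jI|_] := boolP (j \in ctr [::]); last by exists [::].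
  have lt_t : (iota_inv (chart_exps (ctr [::]) j D) < t)%O.
    by rewrite et; apply: iota_inv_chart_exps disjD ND adm0 _ jI.
  have [|s sP] := IHt _ lt_t (fun r => ctr (j :: r)) _ erefl
    (disjoint_chart_exps _ _ disjD).
    by move=> p pP; apply: (adm (j :: p)); rewrite /= ND jI.
  by exists s.
have [s sP] := fin_all_exists IHj.
exists ([::] :: [seq j :: p | j <- enum 'I_n, p <- s j]).
move=> [|j p] //= /and3P[_ jI pP]; rewrite inE /=; apply/allpairsPdep.
by exists j, p; rewrite mem_enum (sP j jI p pP).
Qed.

Theorem proposition5p2 (K : fieldType) (n : nat) (rho : K)
    (A B C : 'X_{1..n}) (hrho : rho != 0%R)
    (hAB : forall i : 'I_n, (A i * B i = 0)%N) :
  let D := Exps A B C in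
  (condN D ->
   forall I : {set 'I_n}, admissible_center D I ->
   forall j : 'I_n, j \in I ->
     total_transform rho I j D (chart_exps I j D) /\
     forall D' : exps n, total_transform rho I j D D' ->
       (iota_inv D' < iota_inv D)%O) /\
  (forall ctr : seq 'I_n -> {set 'I_n},
     admissible_process ctr D -> process_terminates ctr D).
Proof.
move=> D; have disjD : disjoint_exps D by [].
split=> [ND I adm j jI | ctr adm].
  have ttD : total_transform rho I j D (chart_exps I j D).
    exact: total_transform_chart_exps.
  (* By uniqueness, any way of writing the total transform has the computed exponents. *)
  split=> // D' /(total_transform_uniq hrho ttD) <-.
  exact: iota_inv_chart_exps.
split=> [|p pP leaf]; first exact: finitely_many_charts.
(* A leaf violating (M) would have a nonempty center, hence a child. *)
apply/negPn/negP => Np.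
have [_ _ /set0Pn[j jp] _] :=
  admissible_centerP (disjoint_chart_at ctr p disjD) Np (adm p pP Np).
by have := leaf j; rewrite is_chart_rcons pP jp /condN Np.
Qed.
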